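(* Let $\alpha\in \mathrm{GL}(8,2)$ be the matrix \[ \alpha= \begin{bmatrix} 0& 0& 0& 0& 0& 0& 0& 1 \\ 1& 0& 0& 0& 0& 0& 0& 0 \\ 0& 1& 0& 0& 0& 0& 0& 1 \\ 0& 0& 1& 0& 0& 0& 0& 1 \\ 0& 0& 0& 1& 0& 0& 0& 1 \\ 0& 0& 0& 0& 1& 0& 0& 0 \\ 0& 0& 0& 0& 0& 1& 0& 0 \\ 0& 0& 0& 0& 0& 0& 1& 0 \end{bmatrix} \] over $\mathbb{F}_2$, and let $G=\langle\alpha\rangle$, a cyclic group of order $255$. There exists an $LS_2[3](2,3,8)$ large set $\{\mathcal{B}_1,\mathcal{B}_2,\mathcal{B}_3\}$, that is, three pairwise disjoint $2\text{-}(8,3,21;2)$ designs whose union is the set of all $3$-dimensional subspaces of $\mathbb{F}_2^8$, such that each $\mathcal{B}_i$ admits $G$ as a group of automorphisms, and each $\mathcal{B}_i$ consists of $127$ orbits of $G$ on the set of $3$-dimensional subspaces of $\mathbb{F}_2^8$.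
   Context: Let $\mathbb{F}_q$ be the finite field with $q$ elements and $V=\mathbb{F}_q^n$ (column vectors). A $k$-subspace is a $k$-dimensional linear subspace. A (simple) $t\text{-}(n,k,\lambda;q)$ design is a set $\mathcal{B}$ of $k$-subspaces of $V$ such that each $t$-subspace of $V$ is contained in exactly $\lambda$ members of $\mathcal{B}$. An $LS_q[N](t,k,n)$ large set is a set of $N$ pairwise disjoint $t\text{-}(n,k,\lambda;q)$ designs whose union is the set of all $k$-subspaces of $V$. The group $\mathrm{GL}(n,q)$ acts on the set of $k$-subspaces by left multiplication, $\alpha K=\{\alpha x\mid x\in K\}$, and on sets of $k$-subspaces by $\alpha\mathcal{B}=\{\alpha K\mid K\in\mathcal{B}\}$. A design $\mathcal{B}$ admits a subgroup $G\le\mathrm{GL}(n,q)$ as a group of automorphisms if $\alpha\mathcal{B}=\mathcal{B}$ for all $\alpha\in G$. *)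

(* Defs.v *)
From HB Require Import structures.
From mathcomp Require Import all_boot all_order all_algebra all_fingroup.
From mathcomp Require Import all_solvable finmap.

Set Implicit Arguments.
Unset Strict Implicit.
Unset Printing Implicit Defensive.

Import GRing.Theory.
Local Open Scope ring_scope.
Local Open Scope fset_scope.

Section SubspaceDesigns.

Variables (F : finFieldType) (n : nat).
Implicit Types B : {fset {vspace 'cV[F]_n}}.

Definition is_design (t k lambda : nat) B : Prop :=
  (forall K, K \in B -> \dim K = k) /\
  (forall T : {vspace 'cV[F]_n}, \dim T = t ->
     #|` [fset K in B | (T <= K)%VS]| = lambda).

Definition is_large_set (N t k : nat) (L : {fset {fset {vspace 'cV[F]_n}}}) :
    Prop :=
  [/\ #|` L| = N,
      exists lambda, forall B, B \in L -> is_design t k lambda B,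
      forall B B', B \in L -> B' \in L -> B != B' -> [disjoint B & B']%fset &
      forall K : {vspace 'cV[F]_n},
        \dim K = k <-> exists2 B, B \in L & K \in B].

End SubspaceDesigns.

Section LinearAction.

(* The matrices in {'GL_m[F]} have size m.-1.+1, so we take m = n.+1. *)
Variables (F : finFieldType) (n : nat).
Implicit Types (g : {'GL_n.+1[F]}) (G : {group {'GL_n.+1[F]}}).
Implicit Types (K : {vspace 'cV[F]_n.+1}) (B : {fset {vspace 'cV[F]_n.+1}}).

Definition GL_act g K : {vspace 'cV[F]_n.+1} :=
  (linfun (mulmx (GLval g)) @: K)%VS.

Definition GL_act_fset g B : {fset {vspace 'cV[F]_n.+1}} :=
  [fset GL_act g K | K in B].

(* This is a left action, so it is not an instance of the right actions
   {action _ &-> _}, and we define orbits directly. *)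
Definition GL_orbit G K : {fset {vspace 'cV[F]_n.+1}} :=
  [fset GL_act g K | g in G].

Definition admits G B : Prop := forall g, g \in G -> GL_act_fset g B = B.

Definition consists_of_orbits G (k m : nat) B : Prop :=
  exists O : {fset {fset {vspace 'cV[F]_n.+1}}},
    [/\ #|` O| = m,
        forall X, X \in O -> exists2 K, \dim K = k & X = GL_orbit G K &
        forall K, K \in B <-> exists2 X, X \in O & K \in X].

End LinearAction.

Definition alpha_rows : seq (seq nat) :=
  [:: [:: 0; 0; 0; 0; 0; 0; 0; 1];
      [:: 1; 0; 0; 0; 0; 0; 0; 0];
      [:: 0; 1; 0; 0; 0; 0; 0; 1];
      [:: 0; 0; 1; 0; 0; 0; 0; 1];
      [:: 0; 0; 0; 1; 0; 0; 0; 1];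
      [:: 0; 0; 0; 0; 1; 0; 0; 0];
      [:: 0; 0; 0; 0; 0; 1; 0; 0];
      [:: 0; 0; 0; 0; 0; 0; 1; 0]]%N.

Definition alpha_mx : 'M['F_2]_8 :=
  \matrix_(i, j) (nth 0%N (nth [::] alpha_rows i) j)%:R.

Lemma alpha_mx_unit : alpha_mx \is a GRing.unit.
Proof.
pose rows : seq (seq nat) :=
  [:: [:: 0; 1; 0; 0; 0; 0; 0; 0];
      [:: 1; 0; 1; 0; 0; 0; 0; 0];
      [:: 1; 0; 0; 1; 0; 0; 0; 0];
      [:: 1; 0; 0; 0; 1; 0; 0; 0];
      [:: 0; 0; 0; 0; 0; 1; 0; 0];
      [:: 0; 0; 0; 0; 0; 0; 1; 0];
      [:: 0; 0; 0; 0; 0; 0; 0; 1];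
      [:: 1; 0; 0; 0; 0; 0; 0; 0]]%N.
pose B : 'M['F_2]_8 := \matrix_(i, j) (nth 0%N (nth [::] rows i) j)%:R.
suff AB : alpha_mx *m B = 1%:M by case/mulmx1_unit: AB.
apply/matrixP=> -[i lti] [j ltj]; rewrite !mxE !big_ord_recl big_ord0 !mxE.
by apply/eqP; move: i j lti ltj; do 8?[case=> //]; do 8?[case=> //].
Qed.

Definition alpha : {'GL_8['F_2]} := FinRing.unit 'M['F_2]_8 alpha_mx_unit.

(* Main.v *)
From HB Require Import structures.
From Stdlib Require Import NArith FMapPositive.
Require Import Defs.
From mathcomp Require Import all_boot all_order all_algebra all_fingroup.
From mathcomp Require Import all_solvable all_field finmap zify.

(** Identify F_2^8 with F_256 so that [alpha] is multiplication by a primitive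
    element [x]. Give each 3-subspace one of three colours, invariantly under
    multiplication by [x]; such a colouring is determined by the colours of the
    subspaces spanned by [1], [x^a], [x^b]. A finite computation with a table of
    these colours shows that the colour of a triple of vectors depends only on
    its span, and that each 2-subspace containing [1] lies in 21 3-subspaces of
    each colour; as <alpha> is transitive on nonzero vectors, the colour classes
    are designs. No power of [alpha] other than 1 fixes a 3-subspace, so a class,
    which has 127 * 255 members by double counting, is a union of 127 orbits. *)

Set Implicit Arguments.
Unset Strict Implicit.
Unset Printing Implicit Defensive.

Import GRing.Theory.

Local Open Scope ring_scope.
Local Notation V := 'cV['F_2]_8.

(** * Arithmetic in F_256 *)

(* Bit [i] of a byte is the coefficient of [x^i]: [alpha] is multiplication by
   [x] in F_2[x]/(x^8 + x^4 + x^3 + x^2 + 1), and 285 is that modulus in binary. *)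
Definition vec_of_byte (n : N) : V := \col_i (N.testbit n (N.of_nat i))%:R.

Definition byte_mulX (n : N) : N :=
  let m := N.double n in if N.testbit m 8 then N.lxor m 285 else m.

Definition bytes : seq N := traject byte_mulX 1%num 255.

Lemma natr_F2_addb (b c : bool) : (b (+) c)%:R = b%:R + c%:R :> 'F_2.
Proof. by case: b; case: c; apply/eqP. Qed.

Lemma vec_of_byte_lxor m n :
  vec_of_byte (N.lxor m n) = vec_of_byte m + vec_of_byte n.
Proof.
by apply/colP=> i; rewrite !mxE N.lxor_spec -natr_F2_addb; do 2 case: N.testbit.
Qed.

(** The element x is primitive: its 255 powers run through all nonzero bytes. Discrete logarithms
    rest on this. *)
Lemma bytes_range : perm_eq bytes [seq N.of_nat i | i <- iota 1 255].
Proof. by vm_compute. Qed.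

Lemma vec_of_byte_inj m n : (m < 256)%num -> (n < 256)%num ->
  vec_of_byte m = vec_of_byte n -> m = n.
Proof.
move=> lm ln e; apply: N.bits_inj => k.
case: (N.ltb_spec k 8) => [lk|lk].
  have lk' : (N.to_nat k < 8)%N by lia.
  have := congr1 (fun v : V => v (Ordinal lk') 0) e.
  by rewrite !mxE /= N2Nat.id; do 2!case: N.testbit.
have hi p : (p < 256)%num -> N.testbit p k = false.
  case: p => [|p] lp; first by rewrite N.bits_0.
  apply: N.bits_above_log2; apply: (N.lt_le_trans _ 8) => //.
  by apply/N.log2_lt_pow2.
by rewrite !hi.
Qed.

Lemma vec_of_byte_surj v : exists2 n, (n < 256)%num & v = vec_of_byte n.
Proof.
pose b (i : nat) : bool := v (inord i) 0 != 0.
(* The byte with the coordinates of [v] as bits, in Horner form; all 256 bit patterns are then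
   checked. *)
pose n := foldr (fun i m => N.b2n (b i) + 2 * m)%num 0%num (iota 0 8).
have : all (fun i => N.testbit n (N.of_nat i) == b i) (iota 0 8) && (n <? 256)%num.
  rewrite /n /=; move: (b 0) (b 1) (b 2) (b 3) (b 4) (b 5) (b 6) (b 7).
  by do 8 case.
case/andP=> /allP nb /N.ltb_spec0 ln; exists n => //.
apply/colP=> i; rewrite !mxE.
have /eqP -> : N.testbit n (N.of_nat i) == b i by apply: nb; rewrite mem_iota /=.
by rewrite /b inord_val; case: (v i 0) => -[|[|//]] h; apply/eqP.
Qed.

Lemma alpha_mxM_byte n : (n < 256)%num ->
  alpha_mx *m vec_of_byte n = vec_of_byte (byte_mulX n).
Proof.
move=> ln.
(* The matrix product over F_2 written with booleans, a sum becoming an exclusive or, so that all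
   256 bytes can be tested by computation. *)
pose chk (n : N) := all (fun i => N.testbit (byte_mulX n) (N.of_nat i) ==
  foldr (fun j b =>
      (nth 0%N (nth [::] alpha_rows i) j == 1%N) && N.testbit n (N.of_nat j) (+) b)
    false (iota 0 8)) (iota 0 8).
have /allP chkP : all chk [seq N.of_nat i | i <- iota 0 256] by vm_compute.
have {chkP} /allP chkn : chk n.
  by apply: chkP; apply/mapP; exists (N.to_nat n); rewrite ?N2Nat.id // mem_iota; lia.
apply/colP=> i; rewrite !mxE.
have ni : (i : nat) \in iota 0 8 by rewrite mem_iota /=.
rewrite (eqP (chkn _ ni)).
rewrite !big_ord_recl big_ord0 !mxE /= !natr_F2_addb.
have mb j (b : bool) : (nth 0%N (nth [::] alpha_rows i) j)%:R * b%:R =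
   ((nth 0%N (nth [::] alpha_rows i) j == 1%N) && b)%:R :> 'F_2.
  have : all (fun r => all (fun x => (x == 0%N) || (x == 1%N)) r) alpha_rows by [].
  set x := nth _ _ _ => /allP h; have : (x == 0%N) || (x == 1%N).
    rewrite /x; case: (ltnP j (size (nth [::] alpha_rows i))) => lj.
      have /allP := h _ (@mem_nth _ [::] alpha_rows i (ltn_ord i)).
      by apply; apply: mem_nth.
    by rewrite nth_default.
  by case/orP=> /eqP ->; rewrite ?mul0r ?mul1r.
by rewrite !mb.
Qed.

(* Exponents range over [0, 254], and 255 encodes the logarithm of 0. *)
HB.lock Definition vec (i : nat) : V := vec_of_byte (nth 0%num bytes i).

HB.lock Definition dlog (v : V) : nat := index v [seq vec_of_byte n | n <- bytes].

(* Zech logarithm: [x^i + 1 = x^(zech i)]. *)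
Definition zech (i : nat) : nat := index (N.lxor (nth 0%num bytes i) 1) bytes.

(* Exponent of [x^b / x^a], where [b] may be 255 but [a] may not. *)
Definition sub_exp (a b : nat) : nat :=
  if b == 255%N then 255%N else if (b < a)%N then (b + 255 - a)%N else (b - a)%N.

Lemma uniq_bytes : uniq bytes.
Proof.
rewrite (perm_uniq bytes_range) map_inj_uniq ?iota_uniq //; exact: Nat2N.inj.
Qed.

Lemma mem_bytes n : (n \in bytes) = (n != 0%num) && (n <? 256)%num.
Proof.
rewrite (perm_mem bytes_range); apply/mapP/andP => [[i + ->]|[/eqP n0 /N.ltb_spec0 ln]].
  by rewrite mem_iota => ?; split; [apply/eqP | apply/N.ltb_spec0]; lia.
by exists (N.to_nat n); rewrite ?N2Nat.id // mem_iota; lia.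
Qed.

Lemma vec_of_byte0 : vec_of_byte 0 = 0.
Proof. by apply/colP=> i; rewrite !mxE N.bits_0. Qed.

Lemma nth_bytes_lt i : (nth 0%num bytes i < 256)%num.
Proof.
case: (ltnP i 255) => li; last by rewrite nth_default.
have := mem_nth 0%num (li : (i < size bytes)%N).
by rewrite mem_bytes => /andP[_ /N.ltb_spec0].
Qed.

Lemma uniq_vecs : uniq [seq vec_of_byte n | n <- bytes].
Proof.
rewrite map_inj_in_uniq ?uniq_bytes // => m n.
rewrite !mem_bytes => /andP[_ /N.ltb_spec0 lm] /andP[_ /N.ltb_spec0 ln].
exact: vec_of_byte_inj.
Qed.

Lemma vec255 : vec 255 = 0.
Proof. by rewrite !vec.unlock nth_default // vec_of_byte0. Qed.

Lemma zero_notin_vecs : 0 \notin [seq vec_of_byte n | n <- bytes].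
Proof.
apply/mapP=> -[n nb]; rewrite -vec_of_byte0 => e; move: nb.
rewrite mem_bytes => /andP[/eqP n0 /N.ltb_spec0 ln].
by apply: n0; apply/esym/vec_of_byte_inj.
Qed.

Lemma dlog_le v : (dlog v <= 255)%N.
Proof. by rewrite !dlog.unlock (leq_trans (index_size _ _)) // size_map. Qed.

Lemma dlogK v : vec (dlog v) = v.
Proof.
rewrite !vec.unlock !dlog.unlock; case: (vec_of_byte_surj v) => n ln ->.
have [->|n0] := eqVneq n 0%num.
  rewrite vec_of_byte0 nth_default ?vec_of_byte0 //.
  by rewrite (memNindex zero_notin_vecs) size_map.
have nb : n \in bytes by rewrite mem_bytes n0; apply/N.ltb_spec0.
rewrite -(nth_map _ 0) ?nth_index ?map_f //.
by rewrite -[size bytes](size_map vec_of_byte) index_mem map_f.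
Qed.

Lemma vecK i : (i <= 255)%N -> dlog (vec i) = i.
Proof.
rewrite leq_eqVlt => /orP[/eqP ->|li].
  by rewrite vec255 !dlog.unlock (memNindex zero_notin_vecs) size_map.
by rewrite !dlog.unlock !vec.unlock -(nth_map _ 0) // index_uniq ?uniq_vecs ?size_map.
Qed.

Lemma vec_eq0 i : (vec i == 0) = (255 <= i)%N.
Proof.
case: (leqP 255 i) => li.
  by apply/eqP; rewrite !vec.unlock nth_default // vec_of_byte0.
apply/negbTE/eqP => v0; have := vecK (ltnW li).
by rewrite v0 -vec255 vecK // => e; rewrite -e ltnn in li.
Qed.

Lemma dlog_lt v : (dlog v < 255)%N = (v != 0).
Proof. by rewrite -{2}[v]dlogK vec_eq0 -ltnNge. Qed.

(** The conventions at 0 fit: 1 + 1 = 0 gives [zech 0 = 255], and 0 + 1 = 1 gives [zech 255 = 0]. *)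
Lemma vec_zech i : (i <= 255)%N -> vec i + vec 0 = vec (zech i).
Proof.
move=> li; rewrite !vec.unlock /zech -vec_of_byte_lxor (_ : nth _ _ 0 = 1%num) //.
have lx : (N.lxor (nth 0%num bytes i) 1 < 256)%num.
  have /allP : all (fun n => N.lxor n 1 <? 256)%num (0%num :: bytes) by vm_compute.
  have nb : nth 0%num bytes i \in 0%num :: bytes.
    move: li; rewrite leq_eqVlt => /orP[/eqP ->|li].
      by rewrite nth_default ?mem_head.
    by rewrite inE mem_nth ?orbT.
  by move=> /(_ _ nb) /N.ltb_spec0.
case: (boolP (N.lxor (nth 0%num bytes i) 1 \in bytes)) => [nb|nb].
  by rewrite (nth_index 0%num nb).
rewrite (memNindex nb) [nth _ _ (size _)]nth_default //.
move: nb; rewrite mem_bytes negb_and negbK.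
by case/orP=> [/eqP -> //|/N.ltb_spec0].
Qed.

Lemma zech_le i : (zech i <= 255)%N.
Proof. exact: index_size. Qed.

Lemma alpha_mx_vec i : (i < 255)%N -> alpha_mx *m vec i = vec (i.+1 %% 255).
Proof.
move=> li; rewrite !vec.unlock alpha_mxM_byte; last exact: nth_bytes_lt.
have nT j : (j < 255)%N -> nth 0%num bytes j = iter j byte_mulX 1%num.
  by move=> lj; rewrite (set_nth_default 1%num) // [bytes]/bytes nth_traject.
rewrite nT //; case: (ltnP i.+1 255) => lj; first by rewrite modn_small ?nT.
(* The only wrap-around: computation gives x^255 = 1. *)
have -> : i = 254%N by lia.
by congr vec_of_byte; vm_compute.
Qed.

Lemma expmx_vec k i : (i < 255)%N -> alpha_mx ^+ k *m vec i = vec ((i + k) %% 255).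
Proof.
move=> li; elim: k => [|k IH]; first by rewrite expr0 mul1mx addn0 modn_small.
rewrite exprS -mulmxA IH alpha_mx_vec ?ltn_pmod //; congr vec.
by rewrite -(addn1 ((i + k) %% 255)) modnDml -addnA addn1.
Qed.

Lemma alpha_mx_expr255 : alpha_mx ^+ 255 = 1.
Proof.
have e (v : V) : alpha_mx ^+ 255 *m v = v.
  rewrite -(dlogK v); case: (ltnP (dlog v) 255) => l.
    by rewrite expmx_vec // modnDr modn_small.
  by rewrite !vec.unlock nth_default // vec_of_byte0 mulmx0.
apply/matrixP=> i j; have := congr1 (fun v : V => v i 0) (e (delta_mx j 0)).
by rewrite -colE !mxE eqxx andbT.
Qed.

Lemma vec_surj v : exists2 i, (i <= 255)%N & v = vec i.
Proof. by exists (dlog v); rewrite ?dlog_le ?dlogK. Qed.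

Lemma alpha_mx_expr_eq1 k : (alpha_mx ^+ k == 1) = (255 %| k)%N.
Proof.
apply/eqP/dvdnP => [e|[q ->]]; last by rewrite mulnC exprM alpha_mx_expr255 expr1n.
have := congr1 (fun A => A *m vec 0) e; rewrite mul1mx expmx_vec // add0n.
move/(congr1 dlog); rewrite !vecK ?(ltnW (ltn_pmod _ _)) // => /eqP.
by move/dvdnP.
Qed.

(** * Multiplication by powers of x *)

HB.lock Definition shift k (v : V) : V := alpha_mx ^+ k *m v.

Lemma shift_vec k i : (i < 255)%N -> shift k (vec i) = vec ((i + k) %% 255).
Proof. by rewrite shift.unlock; apply: expmx_vec. Qed.

Lemma shift_shift j k v : shift j (shift k v) = shift (j + k) v.
Proof. by rewrite !shift.unlock exprD -mulmxA. Qed.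

Lemma shift_mod k v : shift (k %% 255) v = shift k v.
Proof.
rewrite {2}(divn_eq k 255) !shift.unlock exprD mulnC exprM alpha_mx_expr255 expr1n.
by rewrite mul1r.
Qed.

Lemma shift_zero k : shift k 0 = 0.
Proof. by rewrite shift.unlock mulmx0. Qed.

Lemma shift0 v : shift 0 v = v.
Proof. by rewrite shift.unlock mul1mx. Qed.

Lemma shift255 v : shift 255 v = v.
Proof. by rewrite -shift_mod modnn shift0. Qed.

Lemma shift_add k u v : shift k (u + v) = shift k u + shift k v.
Proof. by rewrite shift.unlock mulmxDr. Qed.

(** Since 254 k + k is a multiple of 255, the exponent 254 k plays the role of -k among natural
    numbers. *)
Lemma shiftK k : cancel (shift k) (shift (254 * k)).
Proof. by move=> v; rewrite shift_shift -mulSnr -shift_mod modnMr shift0. Qed.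

Lemma shift_inj k : injective (shift k).
Proof. exact: can_inj (shiftK k). Qed.

Lemma shift_eq0 k v : (shift k v == 0) = (v == 0).
Proof. by rewrite -[in RHS](inj_eq (@shift_inj k)) shift_zero. Qed.

Lemma vec_neq0 i : (i < 255)%N -> vec i != 0.
Proof. by rewrite vec_eq0 -ltnNge. Qed.

Lemma shift_to_vec0 v : v != 0 -> exists k, shift k v = vec 0.
Proof.
have [i li ->] := vec_surj v; rewrite vec_eq0 -ltnNge => {}li.
by exists (255 - i)%N; rewrite shift_vec // subnKC ?modnn // ltnW.
Qed.

Local Close Scope ring_scope.

(** * The colour table *)

(* A pair [(a, b)] stands for the 3-subspace spanned by [1], [x^a], [x^b] in
   F_256; the c-th list gives the blocks of colour c up to multiplication by
   [x] and the Frobenius power [v -> v^16]. The lists were found by simulated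
   annealing on the incidence matrix of orbits of 2- and 3-subspaces. *)
Definition base_blocks : seq (seq (N * N)) :=
  [:: [:: (1, 2); (1, 4); (1, 7); (1, 8); (1, 11); (1, 17); (1, 20);
          (1, 23); (1, 29); (1, 30); (1, 40); (2, 15); (2, 17); (3, 4);
          (3, 9); (3, 10); (3, 19); (3, 29); (3, 30); (3, 37); (4, 9);
          (4, 31); (4, 41); (4, 79); (5, 6); (5, 10); (5, 13); (5, 32);
          (5, 34); (5, 39); (6, 8); (6, 10); (6, 13); (6, 34); (7, 9);
          (7, 11); (7, 30); (8, 12); (8, 47); (9, 14); (9, 22); (9, 28);
          (9, 37); (9, 49); (11, 12); (11, 17); (11, 20); (11, 52);
          (12, 14); (12, 18); (12, 20); (13, 16); (13, 17); (13, 18);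
          (13, 20); (13, 23); (13, 28); (13, 39); (14, 28); (14, 34);
          (14, 43); (17, 27); (18, 46); (19, 34); (23, 27); (26, 27);
          (34, 41)];
      [:: (1, 3); (1, 6); (1, 10); (1, 16); (1, 18); (1, 19); (1, 38);
          (2, 4); (2, 7); (2, 8); (2, 10); (2, 11); (2, 12); (2, 13);
          (2, 22); (2, 29); (3, 7); (3, 8); (3, 15); (4, 5); (4, 10);
          (4, 12); (4, 13); (4, 34); (5, 8); (5, 14); (5, 19); (5, 20);
          (5, 31); (6, 9); (6, 20); (6, 22); (6, 38); (7, 13); (7, 17);
          (7, 23); (7, 37); (7, 38); (7, 56); (8, 13); (8, 17); (8, 18);
          (8, 20); (9, 16); (9, 17); (9, 26); (11, 13); (11, 16); (11, 27);
          (11, 28); (11, 30); (11, 37); (11, 57); (12, 26); (12, 28);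
          (13, 14); (13, 27); (13, 54); (14, 26); (16, 26); (17, 34);
          (17, 40); (18, 19); (18, 26); (18, 52); (19, 23); (19, 49);
          (22, 27); (23, 28); (23, 43); (28, 56)];
      [:: (1, 5); (1, 9); (1, 13); (1, 15); (1, 27); (1, 37); (1, 41);
          (1, 44); (1, 53); (2, 3); (2, 5); (2, 6); (2, 31); (3, 5);
          (3, 11); (3, 17); (3, 20); (3, 26); (3, 40); (3, 41); (3, 46);
          (4, 6); (4, 8); (4, 16); (4, 26); (4, 30); (4, 44); (5, 7);
          (5, 11); (5, 15); (5, 18); (5, 46); (5, 54); (6, 7); (6, 14);
          (6, 23); (6, 29); (7, 10); (7, 14); (7, 19); (7, 20); (7, 22);
          (7, 44); (8, 60); (9, 11); (9, 13); (9, 19); (9, 23); (9, 29);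
          (9, 36); (9, 52); (11, 19); (11, 26); (12, 13); (12, 39);
          (13, 43); (14, 22); (14, 23); (18, 23); (18, 38); (18, 41);
          (18, 74); (19, 29); (19, 36); (27, 28); (28, 29); (34, 39)]]%num.

(** A precomputed inverse of [bytes]; [N.succ_pos] turns a byte, possibly 0, into a positive key. *)
Definition log_map : PositiveMap.t N :=
  foldl (fun m p => PositiveMap.add (N.succ_pos p.1) p.2 m)
    (PositiveMap.empty N) (zip bytes [seq N.of_nat i | i <- iota 0 255]).

Definition byte_log (n : N) : N :=
  if PositiveMap.find (N.succ_pos n) log_map is Some i then i else 255%num.

Definition sub_expN (a b : N) : N :=
  if N.eqb b 255 then 255%num
  else if N.ltb b a then (b + 255 - a)%num else (b - a)%num.

Definition pair_key (a b : N) : positive := N.succ_pos (a * 256 + b).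

(** The second entry is the image under v -> v^16, which multiplies exponents by 16 and is an
    involution of F_256. *)
Definition add_block (c : nat) (T : PositiveMap.t nat) (ab : N * N) :=
  let x := nth 0%num bytes (N.to_nat ab.1) in
  let y := nth 0%num bytes (N.to_nat ab.2) in
  let K := [:: 1%num; x; y; N.lxor 1 x; N.lxor 1 y; N.lxor x y;
               N.lxor 1 (N.lxor x y)] in
  let L := [seq (n, byte_log n) | n <- K] in
  foldl (fun T u => foldl (fun T v => foldl (fun T w =>
    (* Nonzero vectors u, v, w are dependent over F_2 exactly when two coincide or w = u + v. *)
    if [|| N.eqb u.1 v.1, N.eqb u.1 w.1, N.eqb v.1 w.1 | N.eqb (N.lxor u.1 v.1) w.1]
    then T else
    let a := sub_expN u.2 v.2 in let b := sub_expN u.2 w.2 in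
    PositiveMap.add (pair_key a b) c
     (PositiveMap.add (pair_key (a * 16 mod 255) (b * 16 mod 255)) c T)) T L) T L) T L.

(* The entry at [pair_key a b] is the colour of the span of [1], [x^a], [x^b];
   there is one entry for each ordered basis of a block, divided by its first
   vector. *)
Definition color_map_def : PositiveMap.t nat :=
  foldl (fun T cB => foldl (add_block cB.1) T cB.2) (PositiveMap.empty nat)
    (zip (iota 0 3) base_blocks).

(** A missing key yields 3, the mark of a dependent triple. *)
Definition colorN (T : PositiveMap.t nat) (a b : N) : nat :=
  if PositiveMap.find (pair_key a b) T is Some c then c else 3.

Definition exp_zech : seq (N * N) :=
  [seq (N.of_nat i, N.of_nat (zech i)) | i <- iota 0 256].

(* Locked: unification must not unfold a table of more than 60000 entries. *)
Fact color_map_key : unit. Proof. by []. Qed.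
Definition color_map := locked_with color_map_key color_map_def.

(* The first three conditions make the colour of [(x, y, z)] invariant under
   [y <-> z], [z -> z + x] and [x <-> y], which generate GL(3, 2). *)
Definition pair_check (T : PositiveMap.t nat) (a za b zb : N) : bool :=
  let c := colorN T a b in
  [&& c == colorN T b a,
      c == colorN T a zb,
      N.eqb a 255 || (c == colorN T (sub_expN a 0) (sub_expN a b)) &
      (c < 3)%N || [|| N.eqb a 255, N.eqb a 0, N.eqb b 255, N.eqb b 0,
                         N.eqb b a | N.eqb b za]].

(* 84 = 4 * 21, as each 3-subspace containing a 2-subspace [T] is spanned by [T]
   and any of 4 vectors. *)
Definition count_check (T : PositiveMap.t nat) (s : seq (N * N)) (a : N) : bool :=
  (colorN T a 255 == 3) &&
  (N.eqb a 255 || N.eqb a 0 ||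
   let r := [seq colorN T a q.1 | q <- s] in
   all (fun i => count (pred1 i) r == 84) [:: 0; 1; 2]).

Definition color_check (T : PositiveMap.t nat) (s : seq (N * N)) : bool :=
  all (fun p => all (fun q => pair_check T p.1 p.2 q.1 q.2) s && count_check T s p.1) s.

(** The main computation, over all 256 * 256 pairs of exponents. *)
Lemma color_checkP : color_check color_map exp_zech.
Proof. by rewrite [color_map]unlock; vm_compute. Qed.

HB.lock Definition tcolor (a b : nat) : nat :=
  colorN color_map (N.of_nat a) (N.of_nat b).

Lemma mem_exp_zech a : (a <= 255)%N -> (N.of_nat a, N.of_nat (zech a)) \in exp_zech.
Proof. by move=> la; apply/mapP; exists a; rewrite // mem_iota ltnS. Qed.

Lemma sub_expN_nat a b : sub_expN (N.of_nat a) (N.of_nat b) = N.of_nat (sub_exp a b).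
Proof.
rewrite /sub_expN /sub_exp.
have -> : N.eqb (N.of_nat b) 255 = (b == 255%N) by apply/N.eqb_spec/eqP; lia.
have -> : N.ltb (N.of_nat b) (N.of_nat a) = (b < a)%N by apply/N.ltb_spec0/idP; lia.
by case: eqP => // _; case: ltnP => ?; lia.
Qed.

Lemma of_nat_eqb a b : N.eqb (N.of_nat a) (N.of_nat b) = (a == b).
Proof. by apply/N.eqb_spec/eqP => [|->]; lia. Qed.

Lemma color_map_checks a : (a <= 255)%N ->
  (forall b, (b <= 255)%N ->
     pair_check color_map (N.of_nat a) (N.of_nat (zech a))
       (N.of_nat b) (N.of_nat (zech b))) /\
  count_check color_map exp_zech (N.of_nat a).
Proof.
move=> la; have := color_checkP; have := mem_exp_zech la; have := mem_exp_zech.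
(* The list is abstracted where it serves as a range, but kept as the argument of [count_check],
   which the conclusion mentions. *)
rewrite /color_check; move: {1 2 3 5}exp_zech => s ms ma /allP/(_ _ ma)/andP[/allP sa sc].
by split=> // b /ms/sa.
Qed.

Lemma tcolor_check a b : (a <= 255)%N -> (b <= 255)%N ->
  [/\ tcolor a b = tcolor b a,
      tcolor a b = tcolor a (zech b),
      (a < 255)%N -> tcolor a b = tcolor (sub_exp a 0) (sub_exp a b) &
      (3 <= tcolor a b)%N ->
        [|| a == 255%N, a == 0%N | b \in [:: 255%N; 0%N; a; zech a]]].
Proof.
move=> la lb; have [/(_ b lb) + _] := color_map_checks la.
rewrite /pair_check (sub_expN_nat a 0) sub_expN_nat.
rewrite (of_nat_eqb a 255) (of_nat_eqb a 0) (of_nat_eqb b 255) (of_nat_eqb b 0).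
rewrite !of_nat_eqb.
rewrite tcolor.unlock => /and4P[/eqP e1 /eqP e2 e3 e4]; split => //.
  by move=> l; move: e3; rewrite ltn_eqF // => /eqP.
by move=> c3; move: e4; rewrite !inE ltnNge c3.
Qed.

Lemma tcolorC a b : (a <= 255)%N -> (b <= 255)%N -> tcolor a b = tcolor b a.
Proof. by move=> la lb; have [] := tcolor_check la lb. Qed.

Lemma tcolor_zech a b : (a <= 255)%N -> (b <= 255)%N -> tcolor a (zech b) = tcolor a b.
Proof. by move=> la lb; have [] := tcolor_check la lb. Qed.

Lemma tcolor_swap a b : (a < 255)%N -> (b <= 255)%N ->
  tcolor (sub_exp a 0) (sub_exp a b) = tcolor a b.
Proof. by move=> la lb; have [_ _ ->] := tcolor_check (ltnW la) lb. Qed.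

Lemma tcolor_dep a b : (a <= 255)%N -> (b <= 255)%N -> (3 <= tcolor a b)%N ->
  [|| a == 255%N, a == 0%N | b \in [:: 255%N; 0%N; a; zech a]].
Proof. by move=> la lb; have [] := tcolor_check la lb. Qed.

Lemma tcolor0 a : (a <= 255)%N -> tcolor a 255 = 3%N.
Proof.
by move=> /color_map_checks[_ /andP[/eqP + _]]; rewrite tcolor.unlock.
Qed.

Lemma tcolor_count a i : (0 < a < 255)%N -> (i < 3)%N ->
  count (fun b => tcolor a b == i) (iota 0 256) = 84.
Proof.
move=> /andP[a0 la] li; have [_ /andP[_]] := color_map_checks (ltnW la).
rewrite (of_nat_eqb a 255) (of_nat_eqb a 0) (gtn_eqF a0) (ltn_eqF la) => /allP/(_ i).
have i3 : i \in [:: 0; 1; 2]%N by case: i li => [|[|[|]]].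
move=> /(_ i3)/eqP E; rewrite -[RHS]E /exp_zech -map_comp count_map tcolor.unlock.
exact: eq_count.
Qed.

Local Open Scope ring_scope.

(** * Colours of triples of vectors *)

(* Colour 3 means that the vectors are linearly dependent. *)
HB.lock Definition color (x y z : V) : nat :=
  if x == 0 then 3 else
  let k := (255 - dlog x)%N in tcolor (dlog (shift k y)) (dlog (shift k z)).

Lemma color0 (y z : V) : color 0 y z = 3%N.
Proof. by rewrite color.unlock eqxx. Qed.

Lemma colorE i (y z : V) : (i < 255)%N ->
  color (vec i) y z = tcolor (dlog (shift (255 - i) y)) (dlog (shift (255 - i) z)).
Proof. by move=> li; rewrite color.unlock (negbTE (vec_neq0 li)) vecK // ltnW. Qed.

Lemma color_vec0 (y z : V) : color (vec 0) y z = tcolor (dlog y) (dlog z).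
Proof. by rewrite colorE // subn0 !shift255. Qed.

(** Colours are read after division by the first vector, so a common factor x^k cancels. *)
Lemma color_shift k (x y z : V) :
  color (shift k x) (shift k y) (shift k z) = color x y z.
Proof.
have [i li ->] := vec_surj x; move: li; rewrite leq_eqVlt => /orP[/eqP ->|li].
  by rewrite vec255 shift_zero !color0.
rewrite shift_vec // !colorE ?ltn_pmod // !shift_shift.
have e v : shift (255 - (i + k) %% 255 + k) v = shift (255 - i) v.
  rewrite -shift_mod -[RHS]shift_mod; congr shift; apply/eqP.
  have lr := @ltn_pmod (i + k) 255 isT.
  (* Adding this term to both sides removes the truncated subtractions. *)
  rewrite -(eqn_modDr ((i + k) %% 255 + i)).
  have -> : (255 - (i + k) %% 255 + k + ((i + k) %% 255 + i) = 255 + (i + k))%N by lia.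
  have -> : (255 - i + ((i + k) %% 255 + i) = 255 + (i + k) %% 255)%N by lia.
  by rewrite eqn_modDl modn_mod.
by rewrite !e.
Qed.

(** After scaling the first vector to 1, the translation adds 1 to the third, which is a Zech
    logarithm step in the table. *)
Lemma color_transl (x y z : V) : color x y (z + x) = color x y z.
Proof.
have [->|/shift_to_vec0[k kx]] := eqVneq x 0; first by rewrite !color0.
rewrite -(color_shift k) -[RHS](color_shift k) shift_add kx !color_vec0.
rewrite -[X in X + vec 0]dlogK vec_zech ?dlog_le // vecK ?zech_le //.
by rewrite tcolor_zech ?dlog_le.
Qed.

Lemma color_swap23 (x y z : V) : color x z y = color x y z.
Proof. by rewrite color.unlock; case: ifP => // _; rewrite /= tcolorC ?dlog_le. Qed.

Lemma color_mid0 (x z : V) : color x 0 z = 3%N.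
Proof.
rewrite color.unlock; case: eqP => // _; rewrite /= shift_zero.
by rewrite -{1}vec255 vecK // tcolorC ?dlog_le // tcolor0 ?dlog_le.
Qed.

(** With the first vector scaled to 1 and the second equal to x^a, the swap amounts to dividing by
    x^a, the case covered by [tcolor_swap]. *)
Lemma color_swap12 (x y z : V) : color y x z = color x y z.
Proof.
have [->|/shift_to_vec0[k kx]] := eqVneq x 0; first by rewrite color_mid0 color0.
rewrite -(color_shift k) -[RHS](color_shift k) kx.
have [a la ->] := vec_surj (shift k y).
have [b lb ->] := vec_surj (shift k z).
move: la; rewrite leq_eqVlt => /orP[/eqP ->|la].
  by rewrite vec255 color_mid0 color0.
rewrite color_vec0 !vecK ?(ltnW la) // -(tcolor_swap la lb) colorE //.
have e c : (c <= 255)%N -> shift (255 - a) (vec c) = vec (sub_exp a c).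
  rewrite /sub_exp leq_eqVlt => /orP[/eqP ->|lc]; first by rewrite eqxx vec255 shift_zero.
  rewrite shift_vec // ltn_eqF //; congr vec; case: ltnP => ac.
    by rewrite modn_small; lia.
  have -> : (c + (255 - a) = c - a + 255)%N by lia.
  by rewrite modnDr modn_small //; lia.
have sl c : (c <= 255)%N -> (sub_exp a c <= 255)%N.
  by rewrite /sub_exp; case: ifP => // _; case: ltnP; lia.
by rewrite !e // !vecK // sl.
Qed.

(** Scaling the first vector to 1 permutes the possible [z], and turns the count into that of one
    row of the table. *)
Lemma color_count (x y : V) i : x != 0 -> y != 0 -> y != x -> (i < 3)%N ->
  #|[set z | color x y z == i]| = 84%N.
Proof.
move=> x0 y0 yx li; have [k kx] := shift_to_vec0 x0.
have -> : [set z | color x y z == i] =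
   shift k @^-1: [set z | tcolor (dlog (shift k y)) (dlog z) == i].
  by apply/setP=> z; rewrite !inE -(color_shift k) kx color_vec0.
rewrite card_preimset; last exact: shift_inj.
set a := dlog _.
have a0 : (0 < a < 255)%N.
  rewrite dlog_lt shift_eq0 y0 andbT lt0n; apply: contraNneq yx => a0.
  by apply/eqP/(@shift_inj k); rewrite kx -[LHS]dlogK -/a a0.
have vecI : {in gtn 256 &, injective vec}.
  by move=> b c lb lc /(congr1 dlog); rewrite !vecK.
rewrite -(tcolor_count a0 li).
have : forall b, (b \in iota 0 256) = (b < 256)%N by move=> b; rewrite mem_iota.
move: (iota 0 256) (iota_uniq 0 256) => s us ms.
rewrite -size_filter -(size_map vec).
rewrite -(card_uniqP _); last first.
  rewrite map_inj_in_uniq ?filter_uniq // => b c.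
  by rewrite !mem_filter !ms => /andP[_ lb] /andP[_ lc]; apply: vecI.
apply: eq_card => v; rewrite [LHS]inE; apply/idP/mapP => [vi|[b + ->]].
  by exists (dlog v); rewrite ?dlogK // mem_filter vi ms ltnS dlog_le.
by rewrite mem_filter ms ltnS => /andP[bi lb]; rewrite vecK.
Qed.

Lemma color_dep (x y z : V) : (3 <= color x y z)%N ->
  [|| x == 0, y == 0, y == x | z \in [:: 0; x; y; y + x]].
Proof.
have [//|/shift_to_vec0[k kx]] := eqVneq x 0.
rewrite -(color_shift k) kx color_vec0 => /(tcolor_dep (dlog_le _) (dlog_le _)).
have dE v b : (b <= 255)%N -> (dlog (shift k v) == b) = (shift k v == vec b).
  move=> lb; rewrite -[shift k v in RHS]dlogK.
  rewrite (inj_in_eq (D := gtn 256)) ?inE ?ltnS ?dlog_le // => b1 b2 l1 l2.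
  by move/(congr1 dlog); rewrite !vecK.
rewrite !inE !dE ?dlog_le ?zech_le // -vec_zech ?dlog_le // !dlogK vec255 -kx.
by rewrite -shift_add !shift_eq0 !(inj_eq (@shift_inj k)).
Qed.

(** * Invariance of the colour under change of basis *)

Lemma scale_F2 (W : lmodType 'F_2) (a : 'F_2) (v : W) : a *: v = v *+ (a != 0).
Proof.
have -> : a = (a != 0)%:R by case: a => -[|[|//]] la; apply/eqP.
by rewrite scaler_nat; case: eqP.
Qed.

Lemma span_consP_F2 (x : V) X v :
  reflect (exists a : bool, exists2 u, u \in <<X>>%VS & v = x *+ a + u)
          (v \in <<x :: X>>%VS).
Proof.
rewrite span_cons; apply: (iffP memv_addP) => [[_ /vlineP[a ->] [u uX ->]]|[a [u uX ->]]].
  by exists (a != 0), u; rewrite ?scale_F2.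
by exists (x *+ a); [rewrite rpredMn ?memv_line | exists u].
Qed.

Lemma mem_span2 (x y v : V) : v \in <<[:: x; y]>>%VS ->
  exists a b : bool, v = x *+ a + y *+ b.
Proof.
case/span_consP_F2=> a [u /span_consP_F2[b [w + ->]] ->].
by rewrite span_nil memv0 => /eqP ->; exists a, b; rewrite addr0.
Qed.

Lemma mem_span3 (x y z v : V) : v \in <<[:: x; y; z]>>%VS ->
  exists a b c : bool, v = x *+ a + y *+ b + z *+ c.
Proof.
case/span_consP_F2=> a [u /mem_span2[b [c ->]] ->].
by exists a, b, c; rewrite addrA.
Qed.

(** Colour and span are carried together through elementary operations, so that a basis can be
    exchanged one vector at a time. *)
Definition same_color_span (x y z x' y' z' : V) :=
  color x' y' z' = color x y z /\ <<[:: x'; y'; z']>>%VS = <<[:: x; y; z]>>%VS.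

Lemma scs_refl x y z : same_color_span x y z x y z. Proof. by []. Qed.

Lemma scs_trans x y z x' y' z' x'' y'' z'' :
  same_color_span x y z x' y' z' -> same_color_span x' y' z' x'' y'' z'' ->
  same_color_span x y z x'' y'' z''.
Proof. by case=> c1 s1 [c2 s2]; split; [rewrite c2 | rewrite s2]. Qed.

Lemma scs_swap12 x y z x' y' z' :
  same_color_span x y z x' y' z' -> same_color_span x y z y' x' z'.
Proof.
move/scs_trans; apply; split; first exact: color_swap12.
by apply: eq_span => v; rewrite !inE orbCA.
Qed.

Lemma scs_swap23 x y z x' y' z' :
  same_color_span x y z x' y' z' -> same_color_span x y z x' z' y'.
Proof.
move/scs_trans; apply; split; first exact: color_swap23.
by apply: eq_span => v; rewrite !inE; congr (_ || _); rewrite orbC.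
Qed.

Lemma scs_transl x y z x' y' z' (a : bool) :
  same_color_span x y z x' y' z' ->
  same_color_span x y z x' y' (z' + x' *+ a).
Proof.
case: a; rewrite /= ?mulr0n ?addr0 ?mulr1n //.
move/scs_trans; apply; split; first exact: color_transl.
have in3 (u1 u2 u3 v : V) :
    [|| v == u1, v == u2 | v == u3] -> v \in <<[:: u1; u2; u3]>>%VS.
  by move=> h; rewrite memv_span // !inE.
apply/eqP; rewrite eqEsubv; apply/andP; split; apply/span_subvP => v.
  by rewrite !inE => /or3P[] /eqP ->; rewrite ?memvD // in3 ?eqxx ?orbT.
rewrite !inE => /or3P[] /eqP ->; [by rewrite in3 ?eqxx ?orbT..|].
by rewrite -{1}(addrK x' z') memvB // in3 ?eqxx ?orbT.
Qed.

Lemma scs_add3 x y z x' y' z' (a b : bool) :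
  same_color_span x y z x' y' z' ->
  same_color_span x y z x' y' (z' + x' *+ a + y' *+ b).
Proof. by move=> /(scs_transl a)/scs_swap12/(scs_transl b)/scs_swap12. Qed.

Lemma color_last0 x y : color x y 0 = 3%N.
Proof. by rewrite color_swap23 color_mid0. Qed.

Lemma color_last_dep x y (a b : bool) : color x y (x *+ a + y *+ b) = 3%N.
Proof.
by have [+ _] := scs_add3 a b (scs_refl x y 0); rewrite add0r color_last0.
Qed.

Lemma color_mid_dep x z (a : bool) : color x (x *+ a) z = 3%N.
Proof.
by rewrite color_swap23; have := color_last_dep x z a false; rewrite /= mulr0n addr0.
Qed.

(** Steinitz exchange: swaps and transvections bring [x'], [y'], [z'] into the triple one after the
    other. Where no old vector is left to replace, the new triple is dependent and has colour 3,
    against the hypothesis. *)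
Lemma scs_basis x y z x' y' z' :
  x' \in <<[:: x; y; z]>>%VS -> y' \in <<[:: x; y; z]>>%VS ->
  z' \in <<[:: x; y; z]>>%VS ->
  (color x' y' z' < 3)%N -> same_color_span x y z x' y' z'.
Proof.
move=> Sx Sy Sz c3.
have [y1 [z1 R1]] : exists y1 z1, same_color_span x y z x' y1 z1.
  (* The vector [x'] replaces the last of [x], [y], [z] that has coefficient 1 in it. *)
  have [a [b [[] e]]] := mem_span3 Sx; rewrite /= ?mulr1n ?mulr0n ?addr0 in e.
    exists x, y; rewrite e addrC addrA.
    exact/scs_swap12/scs_swap23/scs_add3/scs_refl.
  case: b e => e; rewrite /= ?mulr1n ?mulr0n ?addr0 in e.
    exists x, z; rewrite e addrC.
    exact/scs_swap12/scs_swap23/scs_transl/scs_swap23/scs_refl.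
  case: a e => e; rewrite /= ?mulr1n ?mulr0n in e; first by exists y, z; rewrite e.
  by move: c3; rewrite e color0.
have := R1; case => _ e1.
rewrite -e1 in Sy Sz.
have [z2 R2] : exists z2, same_color_span x y z x' y' z2.
  have [a [b [[] e]]] := mem_span3 Sy; rewrite /= ?mulr1n ?mulr0n ?addr0 in e.
    exists y1; rewrite e addrC addrA.
    exact/scs_swap23/scs_add3.
  case: b e => e; rewrite /= ?mulr1n ?mulr0n ?addr0 in e.
    exists z1; rewrite e addrC.
    exact/scs_swap23/scs_transl/scs_swap23.
  by move: c3; rewrite e color_mid_dep.
have := R2; case => _ e2; rewrite e1 -e2 in Sz.
have [a [b [[] e]]] := mem_span3 Sz.
  by have := scs_add3 a b R2; rewrite -addrA addrC -[z2]mulr1n -e.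
by move: c3; rewrite e mulr0n addr0 color_last_dep.
Qed.

(** Independence excludes every case of [color_dep]. Conversely, a dependent triple can be permuted
    so that its middle or last vector depends on the preceding ones, which forces colour 3. *)
Lemma free3_color x y z : free [:: x; y; z] = (color x y z < 3)%N.
Proof.
rewrite free_cons free_cons free_cons; apply/idP/idP => [/and4P[]|].
  rewrite ltnNge => xyz yz z0 _; apply/negP => /color_dep.
  rewrite !inE; move: xyz yz z0; rewrite span_nil memv0 => xyz yz z0.
  have x0 : x != 0 by apply: contraNneq xyz => ->; rewrite mem0v.
  have y0 : y != 0 by apply: contraNneq yz => ->; rewrite mem0v.
  have yx : y != x by apply: contraNneq xyz => <-; rewrite memv_span ?mem_head.
  rewrite (negbTE x0) (negbTE y0) (negbTE yx) (negbTE z0) /=.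
  case/or3P=> /eqP zE; move: xyz yz; rewrite zE.
  - by rewrite memv_span ?inE ?eqxx ?orbT.
  - by move=> _; rewrite memv_span ?inE ?eqxx ?orbT.
  - by rewrite -{1}(addKr y x) memvD ?memvN // memv_span ?inE ?eqxx ?orbT.
apply: contraLR; rewrite !negb_and !negbK -leqNgt nil_free orbF.
case/or3P => [/mem_span2[a [b ->]]|/span_consP_F2[a [u + ->]]|].
- by rewrite color_swap12 color_swap23 color_last_dep.
- rewrite span_nil memv0 => /eqP ->.
  by rewrite addr0 color_swap12 color_swap23 color_swap12 color_mid_dep.
- by rewrite span_nil memv0 => /eqP ->; rewrite color_last0.
Qed.

(** * Colour classes are designs *)

(** Double counting, used to pass from subspaces to orbits and, in the version for finite types,
    from vectors to the subspaces they span. *)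
Lemma card_fset_fibers (I J : choiceType) (A : {fset I}) (f : I -> J) m :
  (forall i, i \in A -> #|` [fset j in A | f j == f i]%fset| = m) ->
  #|` A| = (#|` [fset f i | i in A]%fset| * m)%N.
Proof.
move=> fm; rewrite card_fset_sum1 (partition_big_imfset _ f) /=.
rewrite card_fset_sum1 big_distrl /=; apply: eq_big_seq => j /imfsetP[i iA ->].
by rewrite big_fset_condE -card_fset_sum1 mul1n; apply: fm.
Qed.

Lemma card_finset_fibers (I : finType) (J : choiceType) (A : {set I}) (f : I -> J) m :
  (forall i, i \in A -> #|[set j in A | f j == f i]| = m) ->
  #|A| = (#|` [fset f i | i in A]%fset| * m)%N.
Proof.
move=> fm; rewrite -card_finset (@card_fset_fibers _ _ _ f m).
  congr (#|` _| * _)%N; apply/fsetP=> j; apply/imfsetP/imfsetP => -[i /= + ->];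
  by rewrite ?inE /= => iA; exists i; rewrite // ?inE.
move=> i; rewrite inE => iA; rewrite -(fm i iA) -card_finset; congr #|` _|.
by apply/fsetP=> j; rewrite !inE.
Qed.

Lemma card_vspace_F2 (U : {vspace V}) : #|[set v in U]| = (2 ^ \dim U)%N.
Proof. by rewrite cardsE card_vspace card_Fp. Qed.

(** One spanning triple of colour [i] is asked for; by [scs_basis], all bases of the subspace then
    have that colour when [i] is below 3. *)
Definition color_class (i : nat) : {fset {vspace V}} :=
  [fset <<[:: p.1.1; p.1.2; p.2]>>%VS
     | p in [set p : V * V * V | color p.1.1 p.1.2 p.2 == i]]%fset.

Lemma color_classP i K :
  reflect (exists x y z, color x y z = i /\ K = <<[:: x; y; z]>>%VS)
          (K \in color_class i).
Proof.
apply: (iffP (imfsetP _ _ _ _)) => [[[[x y] z] /=]|[x [y [z [c ->]]]]].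
  by rewrite inE => /eqP c ->; exists x, y, z.
by exists (x, y, z); rewrite //= inE; apply/eqP.
Qed.

Lemma dim_span3 (x y z : V) : (color x y z < 3)%N -> \dim <<[:: x; y; z]>> = 3%N.
Proof. by rewrite -free3_color /free => /eqP. Qed.

Lemma color_class_dim i K : (i < 3)%N -> K \in color_class i -> \dim K = 3%N.
Proof. by move=> li /color_classP[x [y [z [c ->]]]]; apply: dim_span3; rewrite c. Qed.

Lemma dim_eq_span_free n (K : {vspace V}) : \dim K = n ->
  exists2 X : n.-tuple V, K = <<X>>%VS & free X.
Proof.
by move=> <-; exists (vbasis K); have /andP[/eqP] := vbasisP K.
Qed.

Lemma color_class_cover K : \dim K = 3%N -> exists2 i, (i < 3)%N & K \in color_class i.
Proof.
case/dim_eq_span_free=> -[[|x [|y [|z [|]]]] //= sX] -> fX.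
exists (color x y z); first by rewrite -free3_color.
by apply/color_classP; exists x, y, z.
Qed.

Lemma color_class_disj i j K : (i < 3)%N -> (j < 3)%N ->
  K \in color_class i -> K \in color_class j -> i = j.
Proof.
move=> li lj /color_classP[x [y [z [c ->]]]] /color_classP[x' [y' [z' [c' e]]]].
have m v : v \in [:: x'; y'; z'] -> v \in <<[:: x; y; z]>>%VS.
  by rewrite e; apply: memv_span.
rewrite -c -c'; have [] // : same_color_span x y z x' y' z'.
by apply: scs_basis; rewrite ?m ?inE ?eqxx ?orbT // c'.
Qed.

Lemma free2_neq (x y : V) : free [:: x; y] = [&& x != 0, y != 0 & y != x].
Proof.
rewrite !free_cons nil_free andbT span_nil memv0.
case: (eqVneq y 0) => [->|y0]; rewrite ?andbF //= ?andbT.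
apply/idP/andP => [nx|[x0 yx]].
  split; first by apply: contraNneq nx => ->; rewrite mem0v.
  by apply: contraNneq nx => ->; rewrite memv_span ?mem_head.
apply/negP => /span_consP_F2[a [u + e]]; rewrite span_nil memv0 => /eqP u0.
move: x0 yx; rewrite e u0 addr0; case: a {e} => /=; first by rewrite eqxx.
by rewrite mulr0n eqxx.
Qed.

(** Outside the plane, [z'] has coefficient 1 at [z], so it differs from [z] by a vector of the
    plane. *)
Lemma scs_third (x y z z' : V) : (color x y z < 3)%N -> z' \in <<[:: x; y; z]>>%VS ->
  z' \notin <<[:: x; y]>>%VS -> same_color_span x y z x y z'.
Proof.
move=> c /mem_span3[a [b [[] ->]]] z'n.
  by rewrite mulr1n addrC addrA; apply/scs_add3/scs_refl.
case/negP: z'n; rewrite mulr0n addr0.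
by rewrite memvD // rpredMn // memv_span ?inE ?eqxx ?orbT.
Qed.

Lemma third_notin (x y z : V) : (color x y z < 3)%N -> z \notin <<[:: x; y]>>%VS.
Proof.
by move=> c; apply: contraL c => /mem_span2[a [b ->]]; rewrite color_last_dep.
Qed.

(** This is the fibre, over a single block, of the map from third vectors to spans; its size 8 - 4
    is computed next. *)
Lemma third_fiber (x y z : V) : (color x y z < 3)%N ->
  [set w | color x y w == color x y z & <<[:: x; y; w]>>%VS == <<[:: x; y; z]>>%VS]
   = [set w in <<[:: x; y; z]>>%VS] :\: [set w in <<[:: x; y]>>%VS].
Proof.
move=> c; apply/setP=> w; rewrite !inE; apply/andP/andP => [[/eqP ew /eqP <-]|[wn wi]].
  by rewrite third_notin ?ew // memv_span ?inE ?eqxx ?orbT.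
by have [-> ->] := scs_third c wi wn.
Qed.

Lemma card_third_fiber (x y z : V) : (color x y z < 3)%N ->
  #|[set w in <<[:: x; y; z]>>%VS] :\: [set w in <<[:: x; y]>>%VS]| = 4%N.
Proof.
move=> c; have f : free [:: x; y; z] by rewrite free3_color.
have f2 : free [:: x; y] by have /catl_free : free ([:: x; y] ++ [:: z]) by [].
rewrite cardsD (setIidPr _); last first.
  apply/subsetP=> v; rewrite !inE; apply: (subvP (sub_span _)) => u.
  by rewrite !inE => /orP[] ->; rewrite ?orbT.
by rewrite !card_vspace_F2 dim_span3 //; move/eqP: f2 => ->.
Qed.

Lemma span3_complete K (x y : V) :
  \dim K = 3%N -> x \in K -> y \in K -> free [:: x; y] ->
  exists2 z, (color x y z < 3)%N & K = <<[:: x; y; z]>>%VS.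
Proof.
move=> dK xK yK fX; have : ~~ (K <= <<[:: x; y]>>)%VS.
  by apply/negP => /dimvS; rewrite dK (eqP fX).
case/subvPn => z zK zT.
have f : free [:: x; y; z].
  have p : perm_eq [:: x; y; z] [:: z; x; y].
    by rewrite -[[:: x; y; z]]/(rcons [:: x; y] z) perm_rcons.
  by rewrite (perm_free p) free_cons zT.
exists z; first by rewrite -free3_color.
apply/esym/eqP; rewrite eqEdim dK (eqP f) leqnn andbT.
by apply/span_subvP => v; rewrite !inE => /or3P[] /eqP ->.
Qed.

Lemma color_class_color i (x y z : V) : (color x y z < 3)%N ->
  (<<[:: x; y; z]>>%VS \in color_class i) = (color x y z == i).
Proof.
move=> c3; apply/color_classP/eqP => [[x' [y' [z' [<- e]]]]|<-]; last by exists x, y, z.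
have [] // : same_color_span x' y' z' x y z.
by apply: scs_basis; rewrite -?e // memv_span ?inE ?eqxx ?orbT.
Qed.

Lemma color_class_design i : (i < 3)%N -> is_design 2 3 21 (color_class i).
Proof.
move=> li; split=> [K|T]; first exact: color_class_dim.
case/dim_eq_span_free=> -[[|x [|y [|]]] //= sX] -> fX.
have := fX; rewrite free2_neq => /and3P[x0 y0 yx].
have := color_count x0 y0 yx li.
(* The 84 vectors [z] giving colour [i] map onto the blocks through T, four to each block. *)
rewrite (@card_finset_fibers _ _ _ (fun z => <<[:: x; y; z]>>%VS) 4%N); last first.
  move=> z; rewrite inE => /eqP c; have c3 : (color x y z < 3)%N by rewrite c.
  apply: (etrans _ (card_third_fiber c3)); rewrite -third_fiber //.
  by apply: eq_card => w; rewrite !inE c.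
move/(congr1 (divn^~ 4%N)); rewrite mulnK // -[(84 %/ 4)%N]/21%N => e21.
apply: (etrans _ e21).
congr #|` _|; apply/fsetP=> K; rewrite !inE /=.
apply/andP/imfsetP => /= [[KB TK]|[z]].
  have xT (v : V) : v \in [:: x; y] -> v \in K by move/memv_span/(subvP TK).
  have [|||z c3 eK] := @span3_complete K x y _ _ _ fX.
  - exact: color_class_dim li KB.
  - by rewrite xT ?mem_head.
  - by rewrite xT // !inE eqxx orbT.
  by exists z; rewrite // inE -color_class_color // -eK.
rewrite inE => /eqP c ->; split; first by apply/color_classP; exists x, y, z.
by apply: sub_span => u; rewrite !inE => /orP[] ->; rewrite ?orbT.
Qed.

(** Choose x nonzero, then y outside {0, x}, then one of [c] third vectors. The set [U] will be the
    whole space and then a single 3-subspace. *)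
Lemma card_triples (U : {set V}) (P : V -> V -> pred V) c :
  (forall x y, x \in U -> y \in U -> free [:: x; y] -> #|[set z | P x y z]| = c) ->
  (forall x y z, P x y z -> [&& x \in U, y \in U & free [:: x; y]]) ->
  0 \in U ->
  #|[set p : V * V * V | P p.1.1 p.1.2 p.2]| = ((#|U| - 1) * (#|U| - 2) * c)%N.
Proof.
move=> Pc PU U0; transitivity (\sum_(q : V * V) \sum_(z | P q.1 q.2 z) 1)%N.
  by rewrite pair_big_dep /= sum1dep_card.
rewrite -(pair_bigA _ (fun x y => \sum_(z | P x y z) 1)%N) /=.
have P0 x y : ~~ [&& x \in U, y \in U & free [:: x; y]] -> (\sum_(z | P x y z) 1 = 0)%N.
  by move=> n; rewrite big1 // => z /PU; rewrite (negbTE n).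
rewrite (bigID (mem (U :\ 0))) /= [X in (_ + X)%N]big1 ?addn0; last first.
  move=> x; rewrite !inE negb_and negbK => h; rewrite big1 // => y _; apply: P0.
  by rewrite free2_neq; case/orP: h => [/eqP ->|/negbTE ->]; rewrite // eqxx !andbF.
rewrite (eq_bigr (fun=> (#|U| - 2) * c)%N) ?sum_nat_const => [|x].
  have -> : #|U :\ 0| = (#|U| - 1)%N by rewrite (cardsD1 0 U) U0 addnC addnK.
  exact: mulnA.
rewrite !inE => /andP[x0 xU].
rewrite (bigID (mem (U :\ 0 :\ x))) /= [X in (_ + X)%N]big1 ?addn0; last first.
  move=> y; rewrite !inE !negb_and !negbK => h; apply: P0.
  rewrite free2_neq.
  by case/or3P: h => [/eqP ->|/eqP ->|/negbTE ->]; rewrite ?eqxx ?andbF.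
rewrite (eq_bigr (fun=> c)) ?sum_nat_const => [|y].
  suff -> : #|U :\ 0 :\ x| = (#|U| - 2)%N by [].
  have := cardsD1 0 U; have := cardsD1 x (U :\ 0); rewrite U0 !inE x0 xU /=.
  by move: #|_| #|_| #|_| => a b d; lia.
rewrite !inE => /and3P[yx y0 yU]; rewrite sum1dep_card Pc // free2_neq.
by rewrite x0 y0 yx.
Qed.

Lemma free3_free2 (x y z : V) : free [:: x; y; z] -> free [:: x; y].
Proof. by have := @catl_free _ _ [:: z] [:: x; y]; apply. Qed.

(** There are 255 * 254 * 84 triples of colour [i], and each block has 7 * 6 * 4 ordered bases. *)
Lemma card_color_class i : (i < 3)%N -> #|` color_class i| = (127 * 255)%N.
Proof.
move=> li; apply/eqP; rewrite -(@eqn_pmul2r (7 * 6 * 4)) //; apply/eqP.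
rewrite -(@card_finset_fibers _ _ _ (fun p : V * V * V => <<[:: p.1.1; p.1.2; p.2]>>%VS)).
  rewrite (@card_triples setT (fun x y z => color x y z == i) 84%N).
  - have cV : #|[set: V]| = 256%N by rewrite cardsT card_mx card_Fp.
    (* Uses 254 = 127 * 2 and 2 * 84 = 7 * 6 * 4; variables keep large unary numbers from being
       evaluated. *)
    have E a b : (a * (b * 2) * 84 = b * a * (7 * 6 * 4))%N by lia.
    by rewrite cV; apply: (E 255%N 127%N).
  - by move=> x y _ _; rewrite free2_neq => /and3P[x0 y0 yx]; apply: color_count.
  - move=> x y z /eqP c; rewrite !inE /=; apply: (@free3_free2 _ _ z).
    by rewrite free3_color c.
  - by rewrite inE.
case=> -[x0 y0] z0; rewrite inE /= => /eqP c0.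
set K := <<_>>%VS; have KB : K \in color_class i.
  by apply/color_classP; exists x0, y0, z0.
have dK := color_class_dim li KB.
transitivity ((#|[set v in K]| - 1) * (#|[set v in K]| - 2) * 4)%N; last first.
  by rewrite card_vspace_F2 dK.
rewrite -(@card_triples _
  (fun x y z => (color x y z == i) && (<<[:: x; y; z]>>%VS == K))).
- by apply: eq_card => -[[x y] z]; rewrite !inE.
- move=> x y; rewrite !inE => xK yK f2.
  have [z c3 eK] := span3_complete dK xK yK f2.
  apply: (etrans _ (card_third_fiber c3)); rewrite -third_fiber //.
  apply: eq_card => w; rewrite !inE -eK; congr (_ && _).
  by move: KB; rewrite eK color_class_color // => /eqP ->.
- move=> x y z /andP[/eqP c /eqP <-]; rewrite !inE !memv_span ?inE ?eqxx ?orbT //=.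
  by apply: (@free3_free2 _ _ z); rewrite free3_color c.
- by rewrite inE mem0v.
Qed.

(** * Orbits of the cyclic group *)

Lemma GLval_expg k : GLval (alpha ^+ k)%g = alpha_mx ^+ k.
Proof. by elim: k => // k IH; rewrite expgS exprS -IH. Qed.

Lemma alpha_expg_eq1 k : ((alpha ^+ k)%g == 1%g) = (255 %| k)%N.
Proof.
rewrite -alpha_mx_expr_eq1 -GLval_expg; apply/eqP/eqP => [-> //|e]; exact: val_inj.
Qed.

Lemma order_alpha : #[alpha]%g = 255%N.
Proof.
apply/eqP; rewrite eqn_dvd; apply/andP; split.
  rewrite order_dvdn alpha_expg_eq1; exact: dvdnn.
by have := expg_order alpha => /eqP; rewrite alpha_expg_eq1.
Qed.

Definition shiftv k (K : {vspace V}) : {vspace V} := GL_act (alpha ^+ k)%g K.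

Lemma shiftv_span k X : shiftv k <<X>>%VS = <<map (shift k) X>>%VS.
Proof.
rewrite /shiftv /GL_act limg_span; congr <<_>>%VS; apply: eq_map => v.
by rewrite lfunE /= GLval_expg shift.unlock.
Qed.

Lemma memv_shiftv k K v : (shift k v \in shiftv k K) = (v \in K).
Proof.
have e u : linfun (mulmx (GLval (alpha ^+ k)%g)) u = shift k u.
  by rewrite lfunE /= GLval_expg shift.unlock.
apply/idP/idP => [/memv_imgP[u uK]|vK]; first by rewrite e => /shift_inj ->.
by rewrite -e memv_img.
Qed.

Lemma span_vbasis (K : {vspace V}) : K = <<vbasis K>>%VS.
Proof. by rewrite (span_basis (vbasisP K)). Qed.

Lemma shiftv_shiftv j k K : shiftv j (shiftv k K) = shiftv (j + k) K.
Proof.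
rewrite (span_vbasis K) !shiftv_span -map_comp; congr <<_>>%VS.
by apply: eq_map => v; rewrite /= shift_shift.
Qed.

Lemma shiftv_mod k K : shiftv (k %% 255) K = shiftv k K.
Proof.
rewrite (span_vbasis K) !shiftv_span; congr <<_>>%VS.
by apply: eq_map => v; rewrite shift_mod.
Qed.

Lemma shiftv0 K : shiftv 0 K = K.
Proof.
by rewrite {1}(span_vbasis K) shiftv_span (eq_map shift0) map_id -span_vbasis.
Qed.

Lemma shiftv_cancel k K : shiftv (254 * k) (shiftv k K) = K.
Proof. by rewrite shiftv_shiftv -mulSnr -shiftv_mod modnMr shiftv0. Qed.

Lemma shiftv_cancel_r k K : shiftv k (shiftv (254 * k) K) = K.
Proof. by rewrite shiftv_shiftv -mulSn -shiftv_mod modnMr shiftv0. Qed.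

Lemma dlog_shift k v : v != 0 -> dlog (shift k v) = ((dlog v + k) %% 255)%N.
Proof.
by rewrite -dlog_lt => l; rewrite -{1}(dlogK v) shift_vec // vecK // ltnW ?ltn_pmod.
Qed.

(* Passing from [K] to [alpha^k K] adds [7 k] to the sum of the discrete
   logarithms of the seven nonzero vectors, and 7 is a unit mod 255. *)
Lemma shiftv_fixed k K : \dim K = 3%N -> shiftv k K = K -> (255 %| k)%N.
Proof.
move=> dK fK.
have e : (\sum_(v in K | (v != 0)%R) dlog v =
          \sum_(v in K | (v != 0)%R) (dlog v + k) %[mod 255])%N.
  (* As [K] is fixed, the shift permutes its nonzero vectors, and the sum can be reindexed along
     it. *)
  rewrite (reindex_inj (@shift_inj k)) /= -[RHS]modn_summ; congr (_ %% _)%N.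
  apply: eq_big => [v|v /andP[_]].
    by rewrite -{1}fK memv_shiftv shift_eq0.
  by rewrite shift_eq0 => /dlog_shift ->.
have c7 : #|[pred v : V | (v \in K) && (v != 0)]| = 7%N.
  have := card_vspace_F2 K; rewrite dK (cardsD1 0) inE mem0v => e8.
  have e7 : #|[set v in K] :\ 0| = 7%N := succn_inj e8.
  by apply: (etrans _ e7); apply: eq_card => v; rewrite !inE andbC.
move: e; rewrite big_split /= sum_nat_const c7; move: (\sum_(v in K | _) _)%N => s e.
have /eqP : (s + 0 = s + 7 * k %[mod 255])%N by rewrite addn0.
by rewrite eqn_modDl eq_sym mod0n -/(255 %| 7 * k)%N Gauss_dvdr.
Qed.

Lemma color_class_shiftv i k K : (shiftv k K \in color_class i) = (K \in color_class i).
Proof.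
have h j L : L \in color_class i -> shiftv j L \in color_class i.
  case/color_classP=> x [y [z [c ->]]]; rewrite shiftv_span; apply/color_classP.
  by exists (shift j x), (shift j y), (shift j z); rewrite color_shift.
by apply/idP/idP => [/(h (254 * k)%N)|/h //]; rewrite shiftv_cancel.
Qed.

Lemma GL_orbitP K K' :
  reflect (exists k, K' = shiftv k K) (K' \in GL_orbit <[alpha]>%G K).
Proof.
apply: (iffP (imfsetP _ _ _ _)) => [[g /= /cycleP[k ->] ->]|[k ->]]; first by exists k.
by exists (alpha ^+ k)%g => //=; apply: mem_cycle.
Qed.

Lemma GL_orbit_shiftv k K : GL_orbit <[alpha]>%G (shiftv k K) = GL_orbit <[alpha]>%G K.
Proof.
apply/fsetP=> K'; apply/GL_orbitP/GL_orbitP => -[j ->].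
  by exists (j + k)%N; rewrite shiftv_shiftv.
by exists (j + 254 * k)%N; rewrite -shiftv_shiftv shiftv_cancel.
Qed.

Lemma GL_orbit_refl K : K \in GL_orbit <[alpha]>%G K.
Proof. by apply/GL_orbitP; exists 0%N; rewrite shiftv0. Qed.

(** By [shiftv_fixed] the stabiliser is trivial, so the map from group elements to images of [K] has
    singleton fibres. *)
Lemma card_GL_orbit K : \dim K = 3%N -> #|` GL_orbit <[alpha]>%G K| = 255%N.
Proof.
move=> dK; rewrite -order_alpha /order -cardsE.
rewrite (@card_finset_fibers _ _ [set g in <[alpha]>%g] (fun g => GL_act g K) 1%N).
  rewrite muln1; congr #|` _|; apply/fsetP=> K'.
  by apply/imfsetP/imfsetP => -[g /= gG ->]; exists g; rewrite ?inE // in gG *.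
move=> g; rewrite inE => /cycleP[k ->]; apply: (etrans _ (cards1 (alpha ^+ k)%g)).
apply: eq_card => h; rewrite !inE; apply/andP/eqP => [[/cycleP[j ->]]|->]; last first.
  by rewrite mem_cycle.
(* Multiply by alpha^(254 k), the inverse of alpha^k, to get an element that fixes [K]. *)
move=> /eqP e; apply/eqP; rewrite -(inj_eq (mulgI (alpha ^+ (254 * k))%g)) -!expgD.
have -> : (alpha ^+ (254 * k + k) = 1)%g.
  by apply/eqP; rewrite alpha_expg_eq1 -mulSnr; apply: dvdn_mulr.
rewrite alpha_expg_eq1; apply: (@shiftv_fixed _ K dK).
by rewrite -shiftv_shiftv [shiftv j K]e -/(shiftv k K) shiftv_cancel.
Qed.

Lemma color_class_orbits i : (i < 3)%N ->
  consists_of_orbits <[alpha]>%G 3 127 (color_class i).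
Proof.
move=> li; exists [fset GL_orbit <[alpha]>%G K | K in color_class i]%fset; split.
(* The 127 * 255 blocks split into orbits of length 255. *)
- have := @card_fset_fibers _ _ (color_class i) (GL_orbit <[alpha]>%G) 255%N.
  rewrite card_color_class // => e; apply/esym/eqP.
  rewrite -(@eqn_pmul2r 255) //; apply/eqP/e => K KB.
  rewrite -(card_GL_orbit (color_class_dim li KB)); congr #|` _|; apply/fsetP=> K'.
  rewrite !inE /=; apply/andP/idP => [[_ /eqP <-]|]; first exact: GL_orbit_refl.
  by case/GL_orbitP=> k ->; rewrite color_class_shiftv GL_orbit_shiftv.
- by move=> X /imfsetP[K /= KB ->]; exists K; rewrite // (color_class_dim li KB).
move=> K; split=> [KB|[X /imfsetP[K' /= KB ->] /GL_orbitP[k ->]]].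
  exists (GL_orbit <[alpha]>%G K); last exact: GL_orbit_refl.
  by apply/imfsetP; exists K.
by rewrite color_class_shiftv.
Qed.

Lemma color_class_admits i : admits <[alpha]>%G (color_class i).
Proof.
move=> g /cycleP[k ->]; apply/fsetP=> K; apply/imfsetP/idP => [[K' /= KB ->]|KB].
  by rewrite -/(shiftv k K') color_class_shiftv.
exists (shiftv (254 * k) K); first by rewrite /= color_class_shiftv.
by rewrite -/(shiftv k _) shiftv_cancel_r.
Qed.

(** The classes are nonempty and disjoint, hence distinct, which makes the large set have exactly
    three members. *)
Lemma color_class_inj i j : (i < 3)%N -> (j < 3)%N ->
  color_class i = color_class j -> i = j.
Proof.
move=> li lj e; have : (0 < #|` color_class i|)%N by rewrite card_color_class.
rewrite cardfs_gt0 => /fset0Pn[K Ki]; apply: (color_class_disj li lj Ki).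
by rewrite -e.
Qed.

Local Close Scope ring_scope.

Theorem mainTheorem2 :
  [/\ cyclic <[alpha]>%g,
      #|<[alpha]>%g| = 255%N &
      exists L : {fset {fset {vspace 'cV['F_2]_8}}},
        is_large_set 3 2 3 L /\
        (forall B, B \in L ->
           [/\ is_design 2 3 21 B,
               admits <[alpha]>%G B &
               consists_of_orbits <[alpha]>%G 3 127 B])].
Proof.
split; [exact: cycle_cyclic | exact: order_alpha |].
pose L := [fset color_class (val i) | i in [set: 'I_3]]%fset.
have LP B : reflect (exists2 i, (i < 3)%N & B = color_class i) (B \in L).
  apply: (iffP (imfsetP _ _ _ _)) => [[i _ ->]|[i li ->]]; first by exists i.
  by exists (Ordinal li); rewrite //= inE.
exists L; split; last first.
  move=> B /LP[i li ->]; split.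
  - exact: color_class_design.
  - exact: color_class_admits.
  - exact: color_class_orbits.
split.
- have := @card_finset_fibers _ _ [set: 'I_3] (fun i => color_class (val i)) 1%N.
  rewrite muln1 cardsT card_ord => <- // i _; apply: (etrans _ (cards1 i)).
  apply: eq_card => j; rewrite !inE; apply/eqP/eqP => [|-> //].
  by move/color_class_inj => /(_ (ltn_ord j) (ltn_ord i))/val_inj.
- by exists 21%N => B /LP[i li ->]; apply: color_class_design.
- move=> B B' /LP[i li ->] /LP[j lj ->] ij.
  apply/fdisjointP => K Ki; apply: contraNN ij => Kj.
  by rewrite (color_class_disj li lj Ki Kj).
move=> K; split=> [/color_class_cover[i li Ki]|[B /LP[i li ->]]].
  by exists (color_class i) => //; apply/LP; exists i.
exact: color_class_dim.
Qed.
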